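(* Let $l\ge2$ and $Q_l=\mathcal{A}_1\oplus\mathcal{A}_l$. If $P$ is a finite poset with $c_{Q_l}(P)=M_{|P|,Q_l}-1$, then there is a poset $Q$ with $|Q|=|P|$ such that one of the following holds: (i) $c_{Q_l}(Q)=M_{|P|,Q_l}-1$ and $Q$ is LOT; (ii) $Q$ is $Q_l$-optimal and $|\max Q|=l$; (iii) $l=2$ and $|P|=5$.
   Context: $\mathcal{A}_n$ is the $n$-element antichain; $P\oplus Q$ is the ordinal sum (disjoint union, orders kept, every element of $P$ below every element of $Q$). $\max P$ is the set of maximal elements of $P$, $\overline{P}=P\setminus\max P$, and $P$ is LOT if $P=\overline{P}\oplus\max P$. $c_Q(P)$ is the number of subsets of $P$ whose induced subposet is isomorphic to $Q$; $M_{n,Q}=\max\{c_Q(P):|P|=n\}$; $P$ is $Q$-optimal if $c_Q(P)=M_{|P|,Q}$. *)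

(* Defs.v *)
From HB Require Import structures.
From mathcomp Require Import all_boot all_order.

Set Implicit Arguments.
Unset Strict Implicit.
Unset Printing Implicit Defensive.

Import Order.TTheory.
Local Open Scope order_scope.

(* As elsewhere in MathComp, each concrete order below lives on an alias of its
   carrier type, so that it does not interfere with the orders the library
   already puts on 'I_n or on sigma types. Displays carry no information. *)

Section OrderIsomorphism.
Variables (d1 d2 : Order.disp_t) (P : finPOrderType d1) (Q : finPOrderType d2).

Definition isomorphism (f : P -> Q) : Prop :=
  bijective f /\ {mono f : x y / x <= y}.

Definition isomorphic : bool :=
  [exists f : {ffun P -> Q},
    [&& injectiveb f, [forall y, y \in codom f]
      & [forall x, forall y, (f x <= f y) == (x <= y)]]].

Lemma isomorphicP : reflect (exists f : P -> Q, isomorphism f) isomorphic.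
Proof.
apply: (iffP existsP) => [[f /and3P[/injectiveP fI /forallP fS /forallP fM]]|].
  exists f; split; last by move=> x y; apply/eqP/(forallP (fM x)).
  exists (fun y => iinv (fS y)) => [x|y]; last exact: f_iinv.
  by apply: fI; rewrite f_iinv.
move=> [f [[g fK gK] fM]]; exists (finfun f); apply/and3P; split.
- by apply/injectiveP => x y; rewrite !ffunE => /(can_inj fK).
- by apply/forallP => y; apply/codomP; exists (g y); rewrite ffunE gK.
- by apply/forallP => x; apply/forallP => y; rewrite !ffunE fM.
Qed.

End OrderIsomorphism.

Definition subposet (d : Order.disp_t) (P : finPOrderType d) (S : {set P}) :=
  {x : P | x \in S}.

Section Subposet.
Variables (d : Order.disp_t) (P : finPOrderType d) (S : {set P}).
HB.instance Definition _ := SubFinite.on (subposet S).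
HB.instance Definition _ :=
  [SubChoice_isSubPOrder of subposet S by <: with d].
End Subposet.

Fact antichain_display : Order.disp_t. Proof. exact: Order.Disp tt tt. Qed.

Definition antichain (n : nat) := 'I_n.

Section Antichain.
Variable n : nat.
HB.instance Definition _ := Finite.on (antichain n).

Fact antichain_anti : antisymmetric (@eq_op (antichain n)).
Proof. by move=> x y /andP[/eqP]. Qed.

Fact antichain_trans : transitive (@eq_op (antichain n)).
Proof. by move=> y x z /eqP->. Qed.

HB.instance Definition _ := Order.Le_isPOrder.Build antichain_display
  (antichain n) (@eqxx (antichain n)) antichain_anti antichain_trans.
End Antichain.

Fact ordsum_display (d1 d2 : Order.disp_t) : Order.disp_t.
Proof. exact: d1. Qed.

Definition ordsum (d1 d2 : Order.disp_t)
  (P : finPOrderType d1) (Q : finPOrderType d2) := (P + Q)%type.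

Section OrdinalSum.
Variables (d1 d2 : Order.disp_t) (P : finPOrderType d1) (Q : finPOrderType d2).
HB.instance Definition _ := Finite.on (ordsum P Q).

Definition ordsum_le (u v : ordsum P Q) : bool :=
  match u, v with
  | inl x, inl y => x <= y
  | inl _, inr _ => true
  | inr _, inl _ => false
  | inr x, inr y => x <= y
  end.

Fact ordsum_refl : reflexive ordsum_le.
Proof. by case=> x /=. Qed.

Fact ordsum_anti : antisymmetric ordsum_le.
Proof. by case=> x [] y //= /le_anti->. Qed.

Fact ordsum_trans : transitive ordsum_le.
Proof. by case=> y [] x [] z //=; apply: le_trans. Qed.

HB.instance Definition _ := Order.Le_isPOrder.Build (ordsum_display d1 d2)
  (ordsum P Q) ordsum_refl ordsum_anti ordsum_trans.
End OrdinalSum.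

Section LOT.
Variables (d : Order.disp_t) (P : finPOrderType d).

Definition maximals : {set P} := [set x | [forall y, ~~ (x < y)]].

Definition ordsum_to_carrier (S T : {set P})
    (u : ordsum (subposet S) (subposet T)) : P :=
  match u with inl x => val x | inr y => val y end.

(* The decomposition is internal: the order of P itself, and not merely one
   isomorphic to it, is that of the ordinal sum. *)
Definition LOT : Prop :=
  isomorphism (@ordsum_to_carrier (~: maximals) maximals).

End LOT.

Definition count_copies (d1 d2 : Order.disp_t)
    (Q : finPOrderType d1) (P : finPOrderType d2) : nat :=
  #|[set S : {set P} | isomorphic (subposet S) Q]|.

(* Every poset with n elements is isomorphic to one carried by 'I_n, and there
   are only finitely many of these: they are the partial_order_on n. *)
Definition is_partial_order (n : nat) (r : {ffun 'I_n * 'I_n -> bool}) : bool :=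
  [&& [forall x, r (x, x)],
      [forall x, forall y, r (x, y) && r (y, x) ==> (x == y)]
    & [forall x, forall y, forall z, r (x, y) && r (y, z) ==> r (x, z)]].

Definition partial_order_on (n : nat) :=
  {r : {ffun 'I_n * 'I_n -> bool} | is_partial_order r}.
HB.instance Definition _ n := Finite.on (partial_order_on n).

Fact ord_poset_display : Order.disp_t. Proof. exact: Order.Disp tt tt. Qed.

Definition ord_poset (n : nat) (r : partial_order_on n) := 'I_n.

Section OrdPoset.
Variables (n : nat) (r : partial_order_on n).
HB.instance Definition _ := Finite.on (ord_poset r).

Definition ord_poset_le (x y : ord_poset r) : bool := val r (x, y).

Fact ord_poset_refl : reflexive ord_poset_le.
Proof. by case/and3P: (valP r) => /forallP. Qed.

Fact ord_poset_anti : antisymmetric ord_poset_le.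
Proof.
case/and3P: (valP r) => _ /forallP rA _ x y rxy.
by apply/eqP; move/forallP: (rA x) => /(_ y)/implyP; apply.
Qed.

Fact ord_poset_trans : transitive ord_poset_le.
Proof.
case/and3P: (valP r) => _ _ /forallP rT y x z rxy ryz.
move/forallP: (rT x) => /(_ y)/forallP/(_ z)/implyP; apply.
exact/andP.
Qed.

HB.instance Definition _ := Order.Le_isPOrder.Build ord_poset_display
  (ord_poset r) ord_poset_refl ord_poset_anti ord_poset_trans.
End OrdPoset.

Definition max_copies (d : Order.disp_t) (n : nat) (Q : finPOrderType d) : nat :=
  (\max_(r : partial_order_on n) count_copies Q (ord_poset r))%N.

Definition optimal (d1 d2 : Order.disp_t)
    (Q : finPOrderType d1) (P : finPOrderType d2) : Prop :=
  count_copies Q P = max_copies #|P| Q.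

Section MaxCopies.
Variables (d : Order.disp_t) (Q : finPOrderType d).

Lemma isomorphic_trans d1 d2 d3 (A : finPOrderType d1) (B : finPOrderType d2)
    (C : finPOrderType d3) :
  isomorphic A B -> isomorphic B C -> isomorphic A C.
Proof.
move=> /isomorphicP[f [fB fM]] /isomorphicP[g [gB gM]].
apply/isomorphicP; exists (g \o f); split; first exact: bij_comp.
by move=> x y; rewrite /= gM fM.
Qed.

Lemma count_copies_le d1 d2 (P : finPOrderType d1) (P' : finPOrderType d2)
    (f : P -> P') :
  {mono f : x y / x <= y} -> (count_copies Q P <= count_copies Q P')%N.
Proof.
move=> fM; have fI : injective f.
  by move=> x y fxy; apply/le_anti; rewrite -!fM fxy lexx.
rewrite /count_copies.
rewrite -(card_imset (mem [set S | isomorphic (subposet S) Q]) (imset_inj fI)).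
apply/subset_leq_card/subsetP => _ /imsetP[S + ->]; rewrite !inE.
apply: isomorphic_trans; apply/isomorphicP.
have gP (u : subposet (f @: S)) : exists x : subposet S, f (val x) == val u.
  by have /imsetP[x xS ->] := valP u; exists (exist _ x xS) => /=.
exists (fun u => xchoose (gP u)); split; last first.
  move=> u v; rewrite -[LHS]/(val (xchoose (gP u)) <= val (xchoose (gP v))).
  by rewrite -fM (eqP (xchooseP (gP u))) (eqP (xchooseP (gP v))).
have hP (x : subposet S) : f (val x) \in f @: S by rewrite imset_f ?(valP x).
exists (fun x => exist _ (f (val x)) (hP x)) => [u|x].
  by apply/val_inj; rewrite /= (eqP (xchooseP (gP u))).
by apply/val_inj/fI; rewrite (eqP (xchooseP (gP _))).
Qed.

Lemma count_copies_le_max d' (P : finPOrderType d') :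
  (count_copies Q P <= max_copies #|P| Q)%N.
Proof.
pose r := [ffun u : 'I_#|P| * 'I_#|P| => enum_val u.1 <= (enum_val u.2 : P)].
have rP : is_partial_order r.
  apply/and3P; split; apply/forallP => x; rewrite ?ffunE //.
    apply/forallP => y; rewrite !ffunE /=.
    by apply/implyP => /le_anti/enum_val_inj ->.
  apply/forallP => y; apply/forallP => z; rewrite !ffunE.
  by apply/implyP => /andP[]; apply: le_trans.
pose f (x : P) : ord_poset (exist _ r rP) := enum_rank x.
rewrite /max_copies (leq_trans _ (leq_bigmax (exist _ r rP))) //.
by apply: (@count_copies_le _ _ _ _ f) => x y; rewrite /Order.le /= /ord_poset_le
  /= ffunE /= !enum_rankK.
Qed.

Lemma max_copies_attained n :
  exists r : partial_order_on n, max_copies n Q = count_copies Q (ord_poset r).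
Proof.
have r0P : is_partial_order [ffun u : 'I_n * 'I_n => u.1 == u.2].
  apply/and3P; split; apply/forallP => x; rewrite ?ffunE //=.
    by apply/forallP => y; rewrite !ffunE; apply/implyP => /andP[].
  apply/forallP => y; apply/forallP => z; rewrite !ffunE /=.
  by apply/implyP => /andP[/eqP->].
have r0 : (0 < #|{: partial_order_on n}|)%N.
  by apply/card_gt0P; exists (exist (@is_partial_order n) _ r0P).
have [r rE] := @bigop.eq_bigmax (partial_order_on n)
  (fun r => count_copies Q (ord_poset r)) r0.
by exists r.
Qed.

End MaxCopies.

(* Main.v *)
Require Import Defs.
From HB Require Import structures.
From mathcomp Require Import all_boot all_order zify.

(* Zykov symmetrization on the maximal elements, for the posets with at least
   M - 1 copies, M being the maximum. Let D <> D' be the strict down-sets of two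
   maximal elements, let S be the set of all s maximal elements having one of
   these two down-sets, and let F(w) be the number of copies once w elements of
   S have down-set D and the other s - w have down-set D'. Fixing the part of a
   copy outside S leaves a binomial coefficient in w, so F is convex, and P has
   F(p) copies for some 0 < p < s. The posets at w = 0 and w = s have more
   maximal elements or fewer classes of them, so by induction each of them has
   at most M - 2 copies or is LOT (a LOT one with M - 1 copies ends the proof).
   They cannot both have at most M - 2, so say w = s is LOT and optimal. If D'
   is contained in D, convexity is strict near s, which forces the end w = 0 to
   be LOT and optimal as well, and D and D' may be exchanged. Otherwise
   Y = D' \ D is an antichain on top of D, P is the ordinal sum of D with the
   disjoint union of p tops and of the ordinal sum of Y with s - p tops, and F
   has a closed form. For l >= 3 it is too convex to be at least M - 1 inside
   unless one end has exactly l maximal elements; for l = 2 it forces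
   |D| = |Y| = 1 and s = 3, that is |P| = 5. *)

Set Implicit Arguments.
Unset Strict Implicit.
Unset Printing Implicit Defensive.

Import Order.TTheory.
Local Open Scope nat_scope.

(** * Discrete convexity *)

Section Convex.

Variables (s : nat) (F : nat -> nat).
Hypothesis Fconv : forall w, w + 2 <= s -> (F w.+1).*2 <= F w + F w.+2.

Lemma convex_slope i k : i <= k -> k < s -> F i.+1 + F k <= F i + F k.+1.
Proof.
elim: k => [|k IHk] ik ks; first by move: ik; rewrite leqn0 => /eqP->; rewrite addnC.
have [->|lt_ik] := eqVneq i k.+1; first by rewrite addnC.
have := IHk ltac:(lia) ltac:(lia); have := @Fconv k ltac:(lia); lia.
Qed.

(** Slopes never decrease, so a slope of at least [e] at [i] persists up to [s]; [e = 0] gives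
    monotonicity. *)
Lemma convex_incr e i k : F i + e <= F i.+1 -> i <= k -> k <= s ->
  F i + (k - i) * e <= F k.
Proof.
move=> Fi; elim: k => [|k IHk] ik ks; first by rewrite sub0n addn0; have -> : i = 0 by lia.
have [->|nik] := eqVneq i k.+1; first by rewrite subnn addn0.
have := IHk ltac:(lia) ltac:(lia); have := @convex_slope i k ltac:(lia) ltac:(lia).
by rewrite subSn ?mulSn; lia.
Qed.

(** Otherwise the step into [p] does not rise, hence by convexity no earlier step does, and
    [F p <= F 0]. *)
Lemma convex_left p : 0 < p -> p <= s -> F 0 < F p -> F p.-1 < F p.
Proof.
move=> p0 ps F0p; rewrite ltnNge; apply/negP => Fp.
suff : F p <= F 0 by lia.
have H j : j < p -> F p <= F (p.-1 - j).
  elim: j => [|j IHj] jp; first by rewrite subn0.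
  have E : (p.-1 - j.+1).+1 = p.-1 - j by lia.
  have := @convex_slope (p.-1 - j.+1) p.-1 ltac:(lia) ltac:(lia).
  rewrite E prednK //; have := IHj ltac:(lia); lia.
by have := H p.-1 ltac:(lia); rewrite subnn.
Qed.

End Convex.

(** * Growth of binomial coefficients *)

Section Binomial.

Lemma bin_convex n j : ('C(n.+1, j)).*2 <= 'C(n, j) + 'C(n.+2, j).
Proof. by case: j => [|[|j]]; rewrite ?bin0 ?bin1 ?binS; lia. Qed.

(** By Pascal's rule the second difference is ['C(n, j)]. *)
Lemma bin_strict_convex n j :
  j <= n -> ('C(n.+1, j.+2)).*2 < 'C(n, j.+2) + 'C(n.+2, j.+2).
Proof. by move=> jn; have := jn; rewrite -bin_gt0 !binS; lia. Qed.

Lemma bin_gt_succ n j : j < n -> j < 'C(n, j).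
Proof.
move=> jn; apply: (@leq_trans 'C(j.+1, j)); last exact: leq_bin2l.
by rewrite -bin_sub // subSnn bin1.
Qed.

Lemma bin_slope a k b : 2 <= b -> 0 < k -> 0 < a -> b < a + k -> 'C(a, b) + 2 <= 'C(a + k, b).
Proof.
move=> b2 k0 a0 bak; have [ba|ab] := leqP b a.
  apply: (@leq_trans 'C(a.+1, b)); last by apply: leq_bin2l; lia.
  case: b b2 ba bak => // b b1 ba _; rewrite binS.
  by have := @bin_gt_succ a b ltac:(lia); lia.
by rewrite bin_small //; have := bin_gt_succ bak; lia.
Qed.

End Binomial.

(** * Arithmetic of the closed form *)

Section Numbers.

(* [F w] is the number of copies when [w] of [s] tops have a strict down-set of
   [d] elements and the others have it enlarged by an antichain of [k] elements,
   as computed in [moved_count_closed]. *)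
Variables (l d k s p K M : nat) (F : nat -> nat).
Hypothesis FE : forall w, w <= s ->
  F w + d * 'C(w, l) = K + d * 'C(k + w, l) + k * 'C(s - w, l).
Hypotheses (d0 : 0 < d) (k0 : 0 < k) (p0 : 0 < p) (ps : p < s).
Hypotheses (FM : forall w, w <= s -> F w <= M) (Fs : F s = M).
Hypotheses (Fp : M <= (F p).+1).
Hypothesis Fconv : forall w, w + 2 <= s -> (F w.+1).*2 <= F w + F w.+2.

(** The last step gains at least 2, so [p < s.-1]. If the step into [p] did not fall, [F s.-1] would
    be at least [M - 1]. So [F] drops from [M] to [M - 1] at [p], convexity forces [p = 1], and from
    there strict growth takes [F s] beyond [M]. *)
Lemma no_interior_near_max : 3 <= l -> l < k + s -> (F 0 = M -> l < s) -> False.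
Proof.
move=> l3 lks F0.
have Fs1 : F s.-1 + 2 <= F s.
  have := FE (leqnn s); have := @FE s.-1 ltac:(lia).
  have := @bin_slope s.-1 k l.-1 ltac:(lia) k0 ltac:(lia) ltac:(lia).
  have -> : s - s = 0 by lia.
  have -> : s - s.-1 = 1 by lia.
  case: l l3 {lks F0} => [|[|[|l']]] // _; case: s ps => // s' _ /=.
  rewrite !addnS !binS !bin0n /= [s' + k]addnC; nia.
have pd : p.+1 < s.
  rewrite ltnNge; apply/negP => sp; have := Fp.
  have -> : p = s.-1 by lia.
  lia.
have Fp1 : F p < F p.-1.
  rewrite ltnNge; apply/negP => Fpp.
  have := @convex_incr _ _ Fconv 0 p.-1 p; have := @convex_incr _ _ Fconv 0 p s.-1.
  have := @convex_slope _ _ Fconv p.-1 p ltac:(lia) ltac:(lia).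
  by rewrite !addn0 !muln0 !addn0 prednK //; lia.
have FMp := @FM p.-1 ltac:(lia).
have p1 : p = 1.
  case: p p0 ps Fp Fp1 FMp => [|[|q]] // _ qs /= Fq Fq1 FMq.
  have := @convex_slope _ _ Fconv q q.+1 ltac:(lia) ltac:(lia).
  have := @FM q ltac:(lia); lia.
move: Fp Fp1 FMp pd; rewrite p1 /= => Fp' Fp1 FMp pd.
have ls : l < s by apply: F0; lia.
(* The slope -1 from 0 to 1 fixes [d * 'C(k, l.-1)], so the next slope is at least
   [k * 'C(s - 2, l - 2) - 1]; that binomial is at least 2 because [l < s]. *)
have F12 : F 1 + 1 <= F 2.
  have := @FE 0 ltac:(lia); have := @FE 1 ltac:(lia); have := @FE 2 ltac:(lia).
  case: l l3 ls {lks F0 Fs1} => [|[|[|l']]] // _; case: s ps => [|[|s']] //= _ ls.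
  have := @bin_gt_succ s' l'.+1 ltac:(lia).
  rewrite !subSS !subn0 !addnS addn0 !binS !bin0n /=; nia.
have := @convex_incr _ _ Fconv 1 1 s F12 ltac:(lia) ltac:(lia).
lia.
Qed.

(** For [l = 2] the second difference is the constant [k], so staying within 1 of [M] at [p] and
    never above [M] leaves few cases. The hypothesis on [F 0] rules out [s = 2]. *)
Lemma near_max_fork : l = 2 -> F 0 + 1 <> M -> [/\ d = 1, k = 1 & s = 3].
Proof.
move=> l2 F0.
have slope w : w < s -> F w.+1 + k * (s - w.+1) = F w + d * k.
  move=> ws; have := @FE w ltac:(lia); have := @FE w.+1 ltac:(lia).
  have -> : s - w = (s - w.+1).+1 by lia.
  by rewrite l2 !addnS !binS ?bin1 ?mulnDr; lia.
case: p p0 ps Fp => // q _ qs Fq.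
have S0 := slope q ltac:(lia); have S1 := slope q.+1 qs.
have M0 := @FM q ltac:(lia); have M1 := @FM q.+1 ltac:(lia); have M2 := @FM q.+2 qs.
have k1 : k = 1.
  have : k <= 2 by nia.
  case: k k0 S0 S1 {slope} => [|[|[|]]] //; lia.
move: slope S0 S1; rewrite k1 !mul1n !muln1 => slope S0 S1.
have S2 w : w < s -> F w.+1 + (s - w.+1) = F w + d by move=> /slope; lia.
(* The slope into [p = q.+1] is 0 or -1: if smaller, [F q] exceeds [M]; if larger, [F q.+2] does. *)
have [d_eq|d_eq] : d = s - q.+1 \/ d.+1 = s - q.+1 by lia.
- have sq : s = q.+2.
    apply/eqP; rewrite eqn_leq qs andbT leqNgt; apply/negP => qs'.
    have := S2 q.+2 qs'; have := @FM q.+3 qs'; lia.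
  case: q qs Fq S0 S1 M0 M1 M2 d_eq sq => [|[|q]] *; [|by split; lia|].
    lia.
  have := S2 q ltac:(lia); have := S2 q.+1 ltac:(lia).
  have := @FM q ltac:(lia); have := @FM q.+1 ltac:(lia); lia.
- have qs' : q.+2 < s.
    rewrite ltn_neqAle qs andbT; apply/eqP => E; have := Fs; rewrite -E; lia.
  have sq : s = q.+3.
    apply/eqP; rewrite eqn_leq qs' andbT leqNgt; apply/negP => qs''.
    have := S2 q.+2 qs'; have := S2 q.+3 qs''; have := @FM q.+4 qs''; lia.
  case: q qs qs' Fq S0 S1 M0 M1 M2 d_eq sq => [|q] *; first by split; lia.
  have := S2 q ltac:(lia); have := @FM q ltac:(lia); lia.
Qed.

End Numbers.

(** * Strict orders, forks, and tops with prescribed down-sets *)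

Section StrictOrders.

Variables (T : finType) (l : nat).
Implicit Types (r : rel T) (x y z : T) (A B S W D : {set T}).

Definition strict r := irreflexive r /\ transitive r.

Definition maxs r := [set x | [forall y, ~~ r x y]].

Definition down r x := [set y | r y x].

(** With [#|A| = l], a copy of [Q_l] given by its bottom and its antichain. Bare relations on a
    fixed carrier let the order change while the elements stay. *)
Definition fork r x A :=
  [forall a in A, r x a] && [forall a in A, forall b in A, ~~ r a b].

Definition forks r := \sum_x #|[set A | fork r x A & #|A| == l]|.

Lemma forkP r x A :
  reflect ((forall a, a \in A -> r x a) /\
           (forall a b, a \in A -> b \in A -> ~~ r a b)) (fork r x A).
Proof.
apply: (iffP andP) => [[/forall_inP xA /forall_inP AA]|[xA AA]]; split=> //.
- by move=> a b aA bA; have /forall_inP := AA a aA; apply.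
- exact/forall_inP.
- by apply/forall_inP => a aA; apply/forall_inP => b bA; apply: AA.
Qed.

Lemma maxsP r x : reflect (forall y, ~~ r x y) (x \in maxs r).
Proof. by rewrite inE; apply: forallP. Qed.

Lemma fork_ext r r' : r =2 r' -> fork r =2 fork r'.
Proof.
move=> rr' x A; congr (_ && _); apply: eq_forallb => a; rewrite ?rr' //.
by congr (_ ==> _); apply: eq_forallb => b; rewrite rr'.
Qed.

Lemma forks_ext r r' : r =2 r' -> forks r = forks r'.
Proof.
move=> rr'; apply: eq_bigr => x _; apply: eq_card => A.
by rewrite !inE (fork_ext rr').
Qed.

Section Retop.

(* [S] is a set of maximal elements; those in [W] are given the strict down-set
   [D], the others [D']. *)
Definition retop r S D D' W : rel T :=
  fun x y => if y \in S then x \in (if y \in W then D else D') else r x y.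

Variables (r : rel T) (S D D' : {set T}).
Hypotheses (r_strict : strict r) (Smax : S \subset maxs r).
Hypotheses (Ddown : forall x y, r x y -> y \in D -> x \in D).
Hypotheses (D'down : forall x y, r x y -> y \in D' -> x \in D').
Hypotheses (DS : [disjoint D & S]) (D'S : [disjoint D' & S]).

Let Smax_no x y : x \in S -> r x y = false.
Proof. by move=> /(subsetP Smax)/maxsP/(_ y)/negbTE. Qed.

Let DSF x : x \in D -> x \in S = false.
Proof. by move=> xD; apply: disjointFr xD. Qed.

Let D'SF x : x \in D' -> x \in S = false.
Proof. by move=> xD; apply: disjointFr xD. Qed.

Lemma retop_strict W : strict (retop r S D D' W).
Proof.
case: r_strict => ri rt; split=> [x|y x z]; rewrite /retop.
  case: ifP => [xS|_]; last exact: ri.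
  by apply/negbTE; apply: contraL xS; case: ifP => _ => [/DSF|/D'SF] ->.
have [zS|zS] := boolP (z \in S); last first.
  by case: ifP => [yS _|_]; [rewrite Smax_no|apply: rt].
by case: (z \in W) => + yD; rewrite ?(DSF yD) ?(D'SF yD) => rxy;
  [apply: Ddown yD|apply: D'down yD].
Qed.

Lemma retop_maxs W : S \subset maxs (retop r S D D' W).
Proof.
apply/subsetP => x xS; apply/maxsP => y; rewrite /retop.
case: ifP => _; last by rewrite Smax_no.
by apply: contraL xS; case: ifP => _ => [/DSF|/D'SF] ->.
Qed.

(* A copy with bottom [x] whose antichain meets the complement of [S] in [B] can
   be completed by the tops with down-set [E]. *)
Definition sees (E : {set T}) x B := (x \in E) && [disjoint B & E].

(** [B] is the part of the antichain outside [S], and the binomial counts its completions by tops.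
    The index [w] enters only through the upper argument, whence convexity. *)
Definition retop_count w :=
  \sum_(x : T) \sum_(B : {set T} |
      [&& x \notin S, [disjoint B & S], fork r x B & #|B| <= l])
    'C(w * sees D x B + (#|S| - w) * sees D' x B, l - #|B|).

(** Tops are below nothing, so each top of [A] is tested separately: its new down-set must contain
    [x] and miss [B]. *)
Lemma fork_retop W x B A : W \subset S -> x \notin S ->
    [disjoint B & S] -> A \subset S ->
  fork (retop r S D D' W) x (B :|: A) =
  fork r x B &&
  (A \subset (if sees D x B then W else set0) :|:
             (if sees D' x B then S :\: W else set0)).
Proof.
move=> WS xS BS AS.
have BSF b : b \in B -> b \in S = false by apply: disjointFr.
have okE a : a \in S -> a \in (if sees D x B then W else set0) :|:
    (if sees D' x B then S :\: W else set0) =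
    sees (if a \in W then D else D') x B.
  move=> aS; rewrite in_setU; case aW: (a \in W);
    by case: (sees D x B); case: (sees D' x B); rewrite !inE ?aS ?aW.
apply/forkP/andP => [[xA AA]|[/forkP[xB BB] /subsetP Aok]]; split.
- apply/forkP; split=> [b bB|b c bB cB].
    by have := xA b; rewrite inE bB /retop BSF //; apply.
  by have := AA b c; rewrite !inE bB cB /retop (BSF c) //; apply.
- apply/subsetP => a aA; have aS := subsetP AS a aA; rewrite okE //.
  apply/andP; split; first by have := xA a; rewrite inE aA orbT /retop aS; apply.
  apply/pred0P => b /=; apply/andP => -[bB bD].
  by have := AA b a; rewrite !inE bB aA orbT /retop aS bD => /(_ isT isT).
- move=> a; rewrite inE => /orP[aB|aA]; rewrite /retop; first by rewrite BSF ?xB.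
  have aS := subsetP AS a aA; rewrite aS.
  by have := Aok a aA; rewrite okE // => /andP[].
- move=> a b; rewrite !inE /retop => /orP aBA /orP[bB|bA].
    rewrite BSF //; case: aBA => [aB|aA]; first exact: BB.
    by rewrite Smax_no // (subsetP AS).
  have bS := subsetP AS b bA; rewrite bS.
  have := Aok b bA; rewrite okE // => /andP[_ BD].
  case: aBA => [aB|aA]; first by rewrite (disjointFr BD).
  by apply: contraL (subsetP AS a aA); case: ifP => _ => [/DSF|/D'SF] ->.
Qed.

(** Copies are grouped by [A :\: S]; a bottom in [S], being maximal, gives none. *)
Lemma retop_countE W : 0 < l -> W \subset S ->
  forks (retop r S D D' W) = retop_count #|W|.
Proof.
move=> l0 WS; apply: eq_bigr => x _.
have [xS|xS] /= := boolP (x \in S).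
  rewrite big_pred0 //; apply/eqP; rewrite cards_eq0; apply/eqP/setP => A.
  rewrite !inE; apply/negbTE; apply/negP => /andP[/forkP[xA _] /eqP cA].
  have /card_gt0P[a aA] : 0 < #|A| by rewrite cA.
  by have := xA a aA; apply/negP; apply: (maxsP _ _ (subsetP (retop_maxs W) x xS)).
rewrite -sum1dep_card (partition_big (fun A => A :\: S)
  (fun B => [&& [disjoint B & S], fork r x B & #|B| <= l])); last first.
  move=> A /andP[fA /eqP cA].
  have dA : [disjoint A :\: S & S].
    by apply/pred0P => a /=; rewrite inE; case: (a \in S); rewrite ?andbF.
  rewrite dA; move: fA; rewrite -{1}(setID A S) setUC fork_retop ?subsetIr //.
  by case/andP=> -> _ /=; rewrite -cA subset_leq_card ?subsetDl.
apply: eq_bigr => B /and3P[BS fB cB]; rewrite sum1dep_card.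
set ok := (if sees D x B then W else set0) :|:
          (if sees D' x B then S :\: W else set0).
have okS : ok \subset S.
  by rewrite subUset; case: sees; case: sees; rewrite ?sub0set ?WS ?subsetDl.
have -> : #|W| * sees D x B + (#|S| - #|W|) * sees D' x B = #|ok|.
  have cSW : #|S :\: W| = #|S| - #|W| by rewrite cardsD (setIidPr WS).
  rewrite /ok; case: sees; case: sees;
    rewrite ?muln1 ?muln0 ?setU0 ?set0U ?cards0 ?addn0 ?add0n ?cSW //.
  have -> : W :|: S :\: W = S.
    by apply/setP => a; rewrite !inE; case: (boolP (a \in W)) => // /(subsetP WS).
  by rewrite subnKC ?subset_leq_card.
rewrite -cards_draws -[RHS](@card_in_imset _ _ (fun A => B :|: A)); last first.
  move=> A A'; rewrite !inE => /andP[/subset_trans/(_ okS) AS _].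
  move=> /andP[/subset_trans/(_ okS) A'S _] /(congr1 (fun X => X :&: S)).
  rewrite !setIUl (setIidPl AS) (setIidPl A'S).
  by rewrite (disjoint_setI0 BS) !set0U.
apply: eq_card => A; rewrite !inE; apply/andP/imsetP.
  move=> [/andP[fA /eqP cA] /eqP AB]; exists (A :&: S); last first.
    by rewrite -AB setUC setID.
  rewrite inE; move: fA; rewrite -{1}(setID A S) setUC AB.
  rewrite fork_retop ?subsetIr // => /andP[_ ->] /=.
  by rewrite -AB -cA -(cardsID S A) addnK.
move=> [A']; rewrite inE => /andP[A'ok /eqP cA'] ->.
have A'S := subset_trans A'ok okS.
have BA' : [disjoint B & A'] by apply: disjointWr BS.
split; last first.
  rewrite setDUl; have /setDidPl -> := BS.
  by have /eqP -> : A' :\: S == set0; rewrite ?setU0 // setD_eq0.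
rewrite fork_retop // fB A'ok /= cardsU (disjoint_setI0 BA') cards0 subn0 cA'.
by rewrite subnKC.
Qed.

End Retop.
End StrictOrders.

(** * Convexity of the count *)

Lemma ltn_sum_ex (I : finType) (P : pred I) (E1 E2 : I -> nat) i0 :
    P i0 -> E1 i0 < E2 i0 -> (forall i, P i -> E1 i <= E2 i) ->
  \sum_(i | P i) E1 i < \sum_(i | P i) E2 i.
Proof.
move=> Pi0 lt0 le12; rewrite (bigD1 i0) //= [ltnRHS](bigD1 i0) //=.
by rewrite -addSn leq_add // leq_sum // => i /andP[/le12].
Qed.

Section RetopConvex.

Variables (T : finType) (l : nat) (r : rel T) (S D D' : {set T}).
Local Notation F := (retop_count l r S D D').

Let term_convex (u v : bool) s w j : w + 2 <= s ->
  ('C(w.+1 * u + (s - w.+1) * v, j)).*2 <=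
  'C(w * u + (s - w) * v, j) + 'C(w.+2 * u + (s - w.+2) * v, j).
Proof.
move=> ws; have -> : s - w.+1 = (s - w.+2).+1 by lia.
have -> : s - w = (s - w.+2).+2 by lia.
case: u; case: v; rewrite /= ?muln1 ?muln0 ?addn0 ?add0n.
- have -> : w.+1 + (s - w.+2).+1 = w + (s - w.+2).+2 by lia.
  have -> : w.+2 + (s - w.+2) = w + (s - w.+2).+2 by lia.
  by rewrite addnn.
- exact: bin_convex.
- by rewrite addnC; exact: bin_convex.
- by rewrite addnn.
Qed.

Lemma retop_count_convex w : w + 2 <= #|S| -> (F w.+1).*2 <= F w + F w.+2.
Proof.
move=> ws; rewrite /retop_count -muln2 big_distrl -big_split /=.
apply: leq_sum => x _; rewrite big_distrl -big_split /=.
by apply: leq_sum => B _; rewrite muln2 term_convex.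
Qed.

(** Since [x] lies in [D] but not in [D'], its term with [B = set0] is ['C(w, l)], strictly convex
    at [w = #|S| - 2] because [l <= #|S|]. *)
Lemma retop_count_strict_convex x w : w + 2 = #|S| -> 2 <= l -> l <= #|S| ->
  x \notin S -> x \in D -> x \notin D' -> (F w.+1).*2 < F w + F w.+2.
Proof.
move=> ws l2 ls xS xD xD'; rewrite /retop_count -muln2 big_distrl -big_split /=.
have ws' : w + 2 <= #|S| by lia.
apply: (@ltn_sum_ex _ _ _ _ x) => // [|y _]; rewrite big_distrl -big_split /=.
  apply: (@ltn_sum_ex _ _ _ _ set0); last by move=> B _; rewrite muln2 term_convex.
    apply/and4P; split; rewrite ?cards0 //.
      by apply/pred0P => y; rewrite /= inE.
    by apply/forkP; split=> a; rewrite inE.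
  have E0 (E : {set T}) : sees E x set0 = (x \in E).
    by rewrite /sees; case: (x \in E) => //=; apply/pred0P => y; rewrite /= inE.
  rewrite !E0 xD (negbTE xD') cards0 subn0 muln2 !muln1 !muln0 !addn0.
  by case: l l2 ls => [|[|l']] // _ ls; apply: bin_strict_convex; lia.
by apply: leq_sum => B _; rewrite muln2 term_convex.
Qed.

End RetopConvex.

(** * LOT orders *)

Section Lot.

Variables (T : finType) (l M : nat).
Implicit Types (r : rel T) (x y z : T) (A B S W D : {set T}).

Definition lot r := forall x y, x \notin maxs r -> y \in maxs r -> r x y.

Lemma max_above r x : strict r -> x \notin maxs r -> exists2 z, z \in maxs r & r x z.
Proof.
move=> [ri rt]; rewrite inE negb_forall => /existsP[y]; rewrite negbK => rxy.
have [z rxz zmax] := @arg_maxnP _ y (r x) (fun z => #|down r z|) rxy.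
exists z => //; apply/maxsP => t; apply/negP => rzt.
have := zmax t (rt _ _ _ rxz rzt); rewrite /= leqNgt => /negP; apply.
apply: proper_card; apply/properP; split.
  by apply/subsetP => u; rewrite !inE => /rt; apply.
by exists z; rewrite !inE ?ri.
Qed.

Lemma lot_downs r : strict r ->
  (forall m m', m \in maxs r -> m' \in maxs r -> down r m = down r m') -> lot r.
Proof.
move=> rs eqd x y xN yM; have [z zM rxz] := max_above rs xN.
by have /setP/(_ x) := eqd z y zM yM; rewrite !inE rxz => <-.
Qed.

Lemma lot_down r m : lot r -> m \in maxs r -> down r m = ~: maxs r.
Proof.
move=> lr mM; apply/setP => x; rewrite !inE; apply/idP/idP => [rxm|xN].
  by rewrite negb_forall; apply/existsP; exists m; rewrite negbK.
by apply: lr => //; rewrite inE.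
Qed.

Hypotheses (l_gt1 : 1 < l) (M_gt0 : 0 < M).
Hypothesis forks_le : forall r, strict r -> forks l r <= M.

Lemma fork_exists r : 0 < forks l r -> exists x A, fork r x A /\ #|A| = l.
Proof.
rewrite lt0n sum_nat_eq0 negb_forall => /existsP[x /=].
rewrite -lt0n => /card_gt0P[A]; rewrite inE => /andP[fA /eqP cA].
by exists x, A.
Qed.

(* Fewer than [l] tops lie in no copy, and moving them to the bottom gains. *)
Lemma lot_optimal_tops r : strict r -> lot r -> forks l r = M -> l <= #|maxs r|.
Proof.
move=> rs lr rM; rewrite leqNgt; apply/negP => ltl.
have [ri rt] := rs.
pose r' x y := (y \notin maxs r) && ((x \in maxs r) || r x y).
have r's : strict r'.
  split=> [x|y x z]; rewrite /r'.
    by rewrite ri orbF; case: (x \in maxs r).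
  move=> /andP[yM rxy] /andP[zM]; rewrite zM (negbTE yM) /= => ryz.
  by case/orP: rxy => [->//|/rt/(_ ryz) ->]; rewrite orbT.
have low x A : fork r x A -> #|A| = l -> forall a, a \in A -> a \notin maxs r.
  move=> /forkP[_ AA] cA a aA; apply/negP => aM.
  have /subsetPn[b bA bM] : ~~ (A \subset maxs r).
    by apply/negP => /subset_leq_card; lia.
  by have := AA b a bA aA; rewrite (lr b a).
have low' x A : fork r x A -> #|A| = l -> fork r' x A.
  move=> fA cA; have lA := low x A fA cA; case/forkP: fA => xA AA.
  apply/forkP; split=> [a aA|a b aA bA]; rewrite /r' lA //= ?xA ?orbT //.
  by rewrite (negbTE (lA a aA)) /= AA.
have := forks_le r's; rewrite leqNgt => /negP; apply; rewrite -rM.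
have [x0 [A0 [f0 c0]]] : exists x A, fork r x A /\ #|A| = l.
  by apply: fork_exists; lia.
have x0N : x0 \notin maxs r.
  have /card_gt0P[a aA] : 0 < #|A0| by lia.
  by apply/negP => /maxsP/(_ a); case/forkP: f0 => ->.
have [y yM _] := max_above rs x0N.
have sub x : [set A | fork r x A & #|A| == l] \subset [set A | fork r' x A & #|A| == l].
  apply/subsetP => A; rewrite !inE => /andP[fA /eqP cA].
  by rewrite cA eqxx low'.
apply: (@ltn_sum_ex _ _ _ _ y) => // [|x _]; last exact/subset_leq_card/sub.
apply/proper_card/properP; split=> //; exists A0; rewrite !inE c0 eqxx andbT.
  apply/forkP; split=> [a aA|a b aA bA]; rewrite /r' (low _ _ f0 c0) ?yM //=.
  by rewrite (negbTE (low _ _ f0 c0 a aA)) /=; case/forkP: f0 => _; apply.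
have /card_gt0P[a aA] : 0 < #|A0| by lia.
by apply/forkP => -[/(_ a aA) rya _]; have /maxsP/(_ a) := yM; rewrite rya.
Qed.

(** The three outcomes of the theorem, for strict orders on the carrier [T]; having [M] copies
    stands for optimality. *)
Definition resolved :=
  [\/ exists r, [/\ strict r, lot r & (forks l r).+1 = M],
      exists r, [/\ strict r, forks l r = M & #|maxs r| = l]
    | l = 2 /\ #|T| = 5].

(** * Moving tops between two down-sets *)

Section TwoTops.

Definition twins r m m' :=
  [set z in maxs r | (down r z == down r m) || (down r z == down r m')].

Definition moved r m m' W :=
  retop r (twins r m m') (down r m) (down r m') W.

Definition moved_count r m m' w :=
  retop_count l r (twins r m m') (down r m) (down r m') w.

Lemma twinsC r m m' : twins r m m' = twins r m' m.
Proof. by apply/setP => z; rewrite !inE orbC. Qed.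

Lemma movedC r m m' W : W \subset twins r m m' ->
  moved r m m' W =2 moved r m' m (twins r m' m :\: W).
Proof.
move=> WS x y; rewrite /moved /retop -(twinsC r m m').
by case: ifP => // yS; rewrite in_setD yS andbT; case: (y \in W).
Qed.

Variables (r : rel T) (m m' : T).
Hypotheses (rs : strict r) (mM : m \in maxs r) (m'M : m' \in maxs r).
Local Notation S := (twins r m m').
Local Notation D := (down r m).
Local Notation D' := (down r m').
Local Notation F := (moved_count r m m').

Lemma twins_max : S \subset maxs r.
Proof. by apply/subsetP => z; rewrite inE => /andP[]. Qed.

Lemma twins_l : m \in S. Proof. by rewrite inE mM eqxx. Qed.
Lemma twins_r : m' \in S. Proof. by rewrite inE m'M eqxx orbT. Qed.

Lemma down_closed z x y : r x y -> y \in down r z -> x \in down r z.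
Proof. by case: rs => _ rt; rewrite !inE; apply: rt. Qed.

Lemma down_twins z : [disjoint down r z & S].
Proof.
apply/pred0P => x /=; rewrite inE; apply/negP => /andP[rxz].
by move=> /(subsetP twins_max)/maxsP/(_ z); rewrite rxz.
Qed.

Lemma moved_strict W : strict (moved r m m' W).
Proof. by apply: retop_strict; rewrite ?twins_max ?down_twins //; apply: down_closed. Qed.

Lemma moved_countE W : W \subset S -> forks l (moved r m m' W) = F #|W|.
Proof.
by apply: retop_countE; rewrite ?twins_max ?down_twins // ?(ltnW l_gt1) //;
  apply: down_closed.
Qed.

Lemma moved_count_le w : w <= #|S| -> F w <= M.
Proof.
rewrite -bin_gt0 -cards_draws => /card_gt0P[W]; rewrite inE => /andP[WS /eqP <-].
by rewrite -moved_countE //; apply/forks_le/moved_strict.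
Qed.

(** This makes the number of copies in [r] itself a value of [moved_count]. *)
Lemma moved_id : r =2 moved r m m' [set z in S | down r z == D].
Proof.
move=> x y; rewrite /moved /retop; case: ifP => // yS; rewrite inE yS /=.
have := yS; rewrite inE => /andP[_].
by case: eqP => [<-|_ /eqP <-]; rewrite inE.
Qed.

Lemma maxs_moved W : maxs r \subset maxs (moved r m m' W).
Proof.
apply/subsetP => x /maxsP xM; apply/maxsP => y; rewrite /moved /retop.
case: ifP => _; last exact: xM.
by case: ifP => _; rewrite inE xM.
Qed.

End TwoTops.
End Lot.

(** * Structure of the order when one end is LOT *)

Section Merge.

Variables (T : finType) (l : nat).
Implicit Types (x y z : T) (A B W : {set T}).
Hypothesis l_gt1 : 1 < l.

Variables (r : rel T) (m m' : T).
Hypotheses (rs : strict r) (mM : m \in maxs r) (m'M : m' \in maxs r).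
Local Notation S := (twins r m m').
Local Notation D := (down r m).
Local Notation D' := (down r m').
Local Notation F := (moved_count l r m m').
Local Notation Y := (D' :\: D).

Hypothesis lotS : lot (moved r m m' S).

Let maxS : S \subset maxs (moved r m m' S).
Proof. exact: subset_trans (twins_max r m m') (maxs_moved _ _ _ _). Qed.

Let downS z : z \in maxs r -> z \notin S -> down (moved r m m' S) z = down r z.
Proof. by move=> zM zS; apply/setP => x; rewrite !inE /moved /retop (negbTE zS). Qed.

Let downSm : down (moved r m m' S) m = D.
Proof. by apply/setP => x; rewrite inE /moved /retop twins_l. Qed.

(** All tops of the LOT order have down-set [D]. A top of [r] outside [S] keeps its down-set, which
    would be [D] and put it in [S]. So [z] is not maximal and lies under some top, whose down-set is
    [D] or [D']. *)
Lemma down_cover z : z \notin S -> z \in D :|: D'.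
Proof.
move=> zS; have zN : z \notin maxs r.
  apply: contraNN (zS) => zM; rewrite inE zM /=.
  have zM' := subsetP (maxs_moved r m m' S) z zM.
  rewrite -(downS zM zS) (lot_down lotS zM').
  by rewrite -(lot_down lotS (subsetP maxS m (twins_l m' mM))) downSm eqxx.
have [t tM rzt] := max_above rs zN.
have [tS|tS] := boolP (t \in S).
  have zt : z \in down r t by rewrite inE.
  have := tS; rewrite inE tM /= in_setU => /orP[]/eqP <-; by rewrite zt ?orbT.
have tM' := subsetP (maxs_moved r m m' S) t tM.
suff zD : z \in D by rewrite in_setU zD.
rewrite -downSm (lot_down lotS (subsetP maxS m (twins_l m' mM))).
by rewrite -(lot_down lotS tM') (downS tM tS) inE.
Qed.

Let DSF z x : x \in down r z -> x \in S = false.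
Proof. by move=> xD; apply: disjointFr (down_twins _ _ _ _) xD. Qed.

(** The maximal elements of a LOT order form the complement of the down-set of any one of them, here
    [D]. *)
Lemma maxs_movedS : maxs (moved r m m' S) = Y :|: S.
Proof.
apply/setP => z; have := lot_down lotS (subsetP maxS m (twins_l m' mM)).
rewrite downSm => /setP/(_ z); rewrite in_setC in_setU in_setD.
have [zD|zD] := boolP (z \in D).
  by rewrite (DSF zD); case: (z \in maxs _).
case: (boolP (z \in S)) => [zS|zS]; first by rewrite (subsetP maxS) ?orbT.
have := down_cover zS; rewrite in_setU (negbTE zD) /= => -> /=.
by case: (z \in maxs _).
Qed.

Hypothesis Y_neq0 : Y != set0.

(** Elements of [Y] are maximal in the LOT order, and the move leaves their down-sets unchanged. *)
Let DY x y : x \in D -> y \in Y -> r x y.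
Proof.
move=> xD yY; have yM : y \in maxs (moved r m m' S) by rewrite maxs_movedS inE yY.
have := lotS _ yM; rewrite /(moved r m m' S) /retop.
have -> : y \in S = false by move: yY; rewrite inE => /andP[_ /DSF].
by apply; rewrite maxs_movedS in_setU in_setD xD (DSF xD).
Qed.

Let YY x y : x \in Y -> y \in Y -> r x y = false.
Proof.
move=> xY yY; have /maxsP/(_ y) : x \in maxs (moved r m m' S).
  by rewrite maxs_movedS inE xY.
rewrite /moved /retop.
have -> : y \in S = false by move: yY; rewrite inE => /andP[_ /DSF].
by move/negbTE.
Qed.

Let DD' : D \subset D'.
Proof.
have [y yY] := set0Pn _ Y_neq0; apply/subsetP => x xD.
by apply: (down_closed rs) (DY xD yY) _; move: yY; rewrite inE => /andP[].
Qed.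

Let coverE z : [|| z \in D, z \in Y | z \in S].
Proof.
case: (boolP (z \in S)) => [|/down_cover]; rewrite ?orbT // in_setU in_setD orbF.
by case: (z \in D).
Qed.

Let YD y : y \in Y -> y \in D = false.
Proof. by rewrite in_setD => /andP[/negbTE]. Qed.

Let YS y : y \in Y -> y \in S = false.
Proof. by rewrite in_setD => /andP[_ /DSF]. Qed.

Let Smax_no x y : x \in S -> r x y = false.
Proof. by move=> /(subsetP (twins_max _ _ _))/maxsP/(_ y)/negbTE. Qed.

Let YrD x y : x \in Y -> y \in D -> r x y = false.
Proof.
move=> /YD xD yD; apply/negP => /(down_closed rs)/(_ yD); by rewrite xD.
Qed.

Lemma maxs_moved0 : maxs (moved r m m' set0) = S.
Proof.
apply/eqP; rewrite eqEsubset; apply/andP; split; last first.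
  exact: subset_trans (twins_max r m m') (maxs_moved _ _ _ _).
apply/subsetP => x /maxsP/(_ m'); rewrite /moved /retop twins_r // in_set0.
have := coverE x; case/or3P => // [/(subsetP DD') ->//|].
by rewrite in_setD => /andP[_ ->].
Qed.

(** All tops now have down-set [D'], which is [D :|: Y], the complement of [S]. *)
Lemma lot_moved0 : lot (moved r m m' set0).
Proof.
move=> x y; rewrite maxs_moved0 => xS yS; rewrite /moved /retop yS in_set0.
have := coverE x; rewrite (negbTE xS) orbF => /orP[/(subsetP DD')//|].
by rewrite in_setD => /andP[].
Qed.

Lemma card_cover : #|T| = #|D| + #|Y| + #|S|.
Proof.
have <- : #|~: S| = #|D| + #|Y|.
  have -> : ~: S = D :|: Y.
    apply/setP => x; rewrite in_setC in_setU.
    have := coverE x; case: (boolP (x \in S)) => [xS _|_]; last by rewrite orbF => ->.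
    by apply/esym/norP; split; apply: contraTN xS; [move=> /DSF ->|move=> /YS ->].
  rewrite cardsU; have -> : D :&: Y = set0; last by rewrite cards0 subn0.
  by apply/setP => x; rewrite !inE; case: (r x m).
by rewrite addnC cardsC.
Qed.

(** An antichain meeting [D] stays in [D], which is below all the rest; one meeting [Y] avoids
    [S :\: W], which is above [Y]; any other consists of tops. *)
Lemma fork_moved_down W x A : W \subset S -> x \in D ->
  fork (moved r m m' W) x A =
  [|| (A \subset D) && fork r x A, A \subset Y :|: W | A \subset S].
Proof.
move=> WS xD.
have rWS y z : z \in S -> moved r m m' W y z = (y \in if z \in W then D else D').
  by rewrite /moved /retop => ->.
have rWN y z : z \in S = false -> moved r m m' W y z = r y z.
  by rewrite /moved /retop => ->.
have xW z : z \in Y :|: S -> moved r m m' W x z.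
  rewrite in_setU => /orP[zY|zS]; first by rewrite rWN ?DY ?YS.
  by rewrite rWS //; case: ifP => // _; apply: (subsetP DD').
apply/forkP/or3P => [[xA AA]|].
  have [/exists_inP[a aA aD]|/exists_inPn noD] := boolP [exists a in A, a \in D].
    have AD : A \subset D.
      apply/subsetP => b bA; have := coverE b; case/or3P => // bY.
        by have := AA a b aA bA; rewrite rWN ?YS // DY.
      have := AA a b aA bA; rewrite rWS //; case: ifP; rewrite ?aD //.
      by rewrite (subsetP DD').
    apply: Or31; rewrite AD; apply/forkP; split=> [b bA|b c bA cA].
      by have := xA b bA; rewrite rWN // (DSF (subsetP AD b bA)).
    by have := AA b c bA cA; rewrite rWN // (DSF (subsetP AD c cA)).
  have AYS b : b \in A -> (b \in Y) || (b \in S).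
    by move=> bA; have := coverE b; rewrite (negbTE (noD b bA)).
  have [/exists_inP[a aA aY]|/exists_inPn noY] := boolP [exists a in A, a \in Y].
    apply: Or32; apply/subsetP => b bA; rewrite in_setU.
    case/orP: (AYS b bA) => [->//|bS].
    have := AA a b aA bA; rewrite rWS //; case: (b \in W); first by rewrite orbT.
    by move: aY; rewrite in_setD => /andP[_ ->].
  apply: Or33; apply/subsetP => b bA; have := AYS b bA.
  by rewrite (negbTE (noY b bA)).
case=> [/andP[/subsetP AD /forkP[xA AA]]|/subsetP AYW|/subsetP AS].
- by split=> [a aA|a b aA bA]; rewrite rWN ?(DSF (AD _ _)) ?xA ?AA.
- split=> [a /AYW|a b /AYW aYW /AYW].
    by rewrite in_setU => /orP[aY|/(subsetP WS) aS]; apply: xW;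
      rewrite in_setU ?aY ?aS ?orbT.
  have aD : a \in D = false.
    by move: aYW; rewrite in_setU => /orP[/YD//|/(subsetP WS)];
      apply: contraTF => /DSF ->.
  rewrite in_setU => /orP[bY|bW].
    rewrite rWN ?YS //; move: aYW; rewrite in_setU => /orP[aY|/(subsetP WS) aS].
      by rewrite YY.
    by rewrite Smax_no.
  by rewrite rWS ?(subsetP WS) // bW aD.
- split=> [a /AS aS|a b /AS aS /AS bS]; first by apply: xW; rewrite in_setU aS orbT.
  by rewrite rWS //; apply: contraTN aS; case: ifP => _ /DSF ->.
Qed.

Lemma fork_moved_middle W x A : W \subset S -> x \in Y ->
  fork (moved r m m' W) x A = (A \subset S :\: W).
Proof.
move=> WS xY; have xD' : x \in D' by move: xY; rewrite in_setD => /andP[].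
apply/forkP/subsetP => [[xA _] a aA|AS].
  have := xA a aA; rewrite /moved /retop; case: ifP => [aS|aS].
    by rewrite in_setD aS andbT; case: (a \in W); rewrite ?(YD xY).
  by have := coverE a; rewrite aS orbF => /orP[aD|aY]; [rewrite YrD|rewrite YY].
rewrite /moved /retop; split=> [a /AS|a b /AS + /AS].
  by rewrite in_setD => /andP[/negbTE -> ->].
rewrite !in_setD => /andP[_ aS] /andP[/negbTE -> ->].
by apply: contraTN aS => /DSF ->.
Qed.

(* An antichain above [x \in D] lies in [D], in [Y :|: W] or in [S]; the last two
   kinds overlap in the subsets of [W], whence the term moved to the left. *)
Lemma moved_count_closed : exists K, forall w, w <= #|S| ->
  F w + #|D| * 'C(w, l) = K + #|D| * 'C(#|Y| + w, l) + #|Y| * 'C(#|S| - w, l).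
Proof.
(* [K] gathers what does not depend on [w]: the copies inside [D], and the antichains in [S] over a
   bottom in [D]. *)
exists (\sum_(x in D) #|[set A : {set T} | (A \subset D) && fork r x A & #|A| == l]|
        + #|D| * 'C(#|S|, l)) => w.
rewrite -bin_gt0 -cards_draws => /card_gt0P[W]; rewrite inE => /andP[WS /eqP <-].
rewrite -moved_countE // /forks.
rewrite (bigID (fun x => x \in D)) (bigID (fun x => x \in Y) (fun x => x \notin D)) /=.
rewrite [X in _ + (_ + X)]big1 ?addn0; last first.
  move=> x /andP[xD xY]; have := coverE x; rewrite (negbTE xD) (negbTE xY) => xS.
  apply/eqP; rewrite cards_eq0; apply/eqP/setP => A; rewrite !inE.
  apply/negbTE; apply/negP => /andP[/forkP[xA _] /eqP cA].
  have /card_gt0P[a aA] : 0 < #|A| by lia.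
  have /maxsP/(_ a) := subsetP (subset_trans (twins_max r m m') (maxs_moved r m m' W)) x xS.
  by rewrite xA.
rewrite [X in _ + X + _](eq_bigl (fun x => x \in Y)); last first.
  by move=> x; rewrite in_setD; case: (x \in D).
rewrite [X in _ + X + _](eq_bigr (fun=> 'C(#|S| - #|W|, l))); last first.
  move=> x xY; have <- : #|S :\: W| = #|S| - #|W| by rewrite cardsD (setIidPr WS).
  by rewrite -cards_draws; apply: eq_card => A; rewrite !inE fork_moved_middle.
rewrite sum_nat_const addnAC; congr (_ + _).
rewrite -!sum_nat_const -!big_split /=; apply: eq_bigr => x xD.
have -> : #|Y| + #|W| = #|Y :|: W|.
  rewrite cardsU; have -> : Y :&: W = set0; last by rewrite cards0 subn0.
  apply/setP => y; rewrite in_setI in_set0; apply/negP => /andP[yY].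
  by move=> /(subsetP WS); rewrite YS.
have {2}-> : W = (Y :|: W) :&: S.
  rewrite setIUl (setIidPl WS); have -> : Y :&: S = set0; last by rewrite set0U.
  by apply/setP => y; rewrite in_setI in_set0; apply/negP => /andP[/YS ->].
set G := [set A : {set T} | (A \subset D) && _ & _].
pose dr (E : {set T}) := [set A : {set T} | A \subset E & #|A| == l].
rewrite -!cards_draws -!/(dr _).
have -> : [set A | fork (moved r m m' W) x A & #|A| == l] = G :|: (dr (Y :|: W) :|: dr S).
  by apply/setP => A; rewrite !inE fork_moved_down // -!andb_orl.
have -> : dr ((Y :|: W) :&: S) = dr (Y :|: W) :&: dr S.
  apply/setP => A; rewrite !inE subsetI.
  by case: (_ == l); rewrite ?andbT ?andbF.
have -> : #|G :|: (dr (Y :|: W) :|: dr S)| = #|G| + #|dr (Y :|: W) :|: dr S|.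
  rewrite [LHS]cardsU; have -> : G :&: (dr (Y :|: W) :|: dr S) = set0; last first.
    by rewrite cards0 subn0.
  apply/setP => A; rewrite !inE; apply/negbTE; apply/negP.
  move=> /andP[/andP[/andP[/subsetP AD _] /eqP cA]].
  have /card_gt0P[a aA] : 0 < #|A| by lia.
  have aD := AD a aA; rewrite -andb_orl => /andP[/orP[] /subsetP/(_ a aA) + _].
    rewrite in_setU => /orP[/YD|/(subsetP WS)]; first by rewrite aD.
    by rewrite (DSF aD).
  by rewrite (DSF aD).
by rewrite -addnA cardsUI -addnA; congr (_ + _); rewrite addnC.
Qed.

End Merge.

(** * Induction for orders with at least [M - 1] copies *)

Section NearMax.

Variables (T : finType) (l M : nat).
Implicit Types (r : rel T) (x y z m : T) (A B W : {set T}).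
Hypotheses (l_gt1 : 1 < l) (M_gt0 : 0 < M).
Hypothesis forks_le : forall r : rel T, strict r -> forks l r <= M.
Local Notation resolved := (resolved T l M).

Lemma moved_count_convex r m m' w : w + 2 <= #|twins r m m'| ->
  (moved_count l r m m' w.+1).*2 <= moved_count l r m m' w + moved_count l r m m' w.+2.
Proof. exact: retop_count_convex. Qed.

Lemma moved_count0 r m m' : strict r ->
  moved_count l r m m' 0 = moved_count l r m' m #|twins r m' m|.
Proof.
move=> rs; rewrite -[in LHS](cards0 T) -moved_countE ?sub0set //.
by rewrite (forks_ext l (movedC (sub0set _))) setD0 moved_countE.
Qed.

Lemma near_max_index r m m' : strict r -> m \in maxs r -> m' \in maxs r ->
    down r m != down r m' ->
  exists p, [/\ 0 < p, p < #|twins r m m'| & moved_count l r m m' p = forks l r].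
Proof.
move=> rs mM m'M DD'; pose C := [set z in twins r m m' | down r z == down r m].
have CS : C \subset twins r m m' by apply/subsetP => z; rewrite inE => /andP[].
exists #|C|; split.
- by apply/card_gt0P; exists m; rewrite inE eqxx andbT twins_l.
- apply/proper_card/properP; split=> //; exists m'; first exact: twins_r.
  by rewrite inE eq_sym (negbTE DD') andbF.
- by rewrite -moved_countE // -(forks_ext l (moved_id _ _ _)).
Qed.

(** The closed form applies. For [l = 2] it yields [#|T| = 1 + 1 + 3]; for [l >= 3] it is
    contradictory unless an optimal end has exactly [l] tops, fewer being impossible by
    [lot_optimal_tops]. *)
Lemma merge_up r m m' : strict r -> m \in maxs r -> m' \in maxs r ->
    down r m != down r m' -> lot (moved r m m' (twins r m m')) ->
    moved_count l r m m' #|twins r m m'| = M -> M <= (forks l r).+1 ->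
    down r m' :\: down r m != set0 -> moved_count l r m m' 0 + 1 <> M ->
  resolved.
Proof.
move=> rs mM m'M DD' lotS Fs Fr Y0 F0.
have [p [p0 ps Fp]] := near_max_index rs mM m'M DD'.
have [K FE] := moved_count_closed l_gt1 rs mM m'M lotS Y0.
set S := twins r m m' in lotS Fs ps FE *.
set D := down r m in Y0 FE *; set Y := down r m' :\: D in Y0 FE *.
have optS : forks l (moved r m m' S) = M by rewrite moved_countE.
have strS : strict (moved r m m' S) by apply: moved_strict.
have cS : #|maxs (moved r m m' S)| = #|Y| + #|S|.
  rewrite (maxs_movedS rs mM lotS) cardsU.
  have -> : Y :&: S = set0; last by rewrite cards0 subn0.
  apply/setP => y; rewrite in_set0; apply/negP; rewrite !in_setI in_setD.
  by move=> /andP[/andP[_ yD']]; rewrite (disjointFr (down_twins r m m' m') yD').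
have k0 : 0 < #|Y| by rewrite card_gt0.
(* The bottom of any copy in the LOT order is not maximal there, so it lies in [D]. *)
have d0 : 0 < #|D|.
  have [x [A [fA cA]]] : exists x A, fork (moved r m m' S) x A /\ #|A| = l.
    by apply: fork_exists; rewrite optS.
  have /card_gt0P[a aA] : 0 < #|A| by lia.
  have xN : x \notin maxs (moved r m m' S).
    by apply/negP => /maxsP/(_ a); case/forkP: fA => ->.
  have mMS : m \in maxs (moved r m m' S) by rewrite (subsetP (maxs_moved _ _ _ _)).
  apply/card_gt0P; exists x; have := lotS _ _ xN mMS.
  by rewrite /moved /retop (twins_l _ mM).
have lS := lot_optimal_tops l_gt1 M_gt0 forks_le strS lotS optS.
have [lE|lN] := eqVneq #|maxs (moved r m m' S)| l.
  by apply: Or32; exists (moved r m m' S).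
have FM := moved_count_le l_gt1 forks_le (m := m) (m' := m') rs.
have Fp' : M <= (moved_count l r m m' p).+1 by rewrite Fp.
have Fc := @moved_count_convex r m m'.
have [l2|l3] : l = 2 \/ 2 < l by lia.
  have [d1 k1 s3] := near_max_fork FE d0 k0 p0 ps FM Fs Fp' l2 F0.
  by apply: Or33; split=> //; rewrite (card_cover rs mM lotS) -/D -/Y -/S; lia.
have [l0|lN0] := eqVneq #|S| l.
  have [F0M|F0M] := eqVneq (moved_count l r m m' 0) M.
    apply: Or32; exists (moved r m m' set0); split.
    - exact: moved_strict.
    - by rewrite moved_countE ?sub0set // cards0.
    - by rewrite (maxs_moved0 rs mM m'M lotS).
  exfalso; apply: (no_interior_near_max FE d0 k0 p0 ps FM Fs Fp' Fc l3); first lia.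
  by move=> /eqP; rewrite (negbTE F0M).
exfalso; apply: (no_interior_near_max FE d0 k0 p0 ps FM Fs Fp' Fc l3); first lia.
move=> F0M; have opt0 : forks l (moved r m m' set0) = M.
  by rewrite moved_countE ?sub0set // cards0.
have := lot_optimal_tops l_gt1 M_gt0 forks_le (moved_strict m m' rs set0)
  (lot_moved0 rs mM m'M lotS Y0) opt0.
by rewrite (maxs_moved0 rs mM m'M lotS Y0) -/S; lia.
Qed.

(** Otherwise the step into [p] rises, and so do all later ones. As [F p] is at least [M - 1], this
    leaves [p = s - 1] with slope 1 on both sides, against strict convexity there, which an element
    of [D] outside [D'] provides. *)
Lemma merge_down r m m' : strict r -> m \in maxs r -> m' \in maxs r ->
    down r m != down r m' -> lot (moved r m m' (twins r m m')) ->
    moved_count l r m m' #|twins r m m'| = M -> M <= (forks l r).+1 ->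
    down r m' :\: down r m = set0 -> M < moved_count l r m m' 0 + 2.
Proof.
move=> rs mM m'M DD' lotS Fs Fr Y0; rewrite ltnNge; apply/negP => F0.
have [p [p0 ps Fp]] := near_max_index rs mM m'M DD'.
have optS : forks l (moved r m m' (twins r m m')) = M by rewrite moved_countE.
have := lot_optimal_tops l_gt1 M_gt0 forks_le (moved_strict m m' rs _) lotS optS.
rewrite (maxs_movedS rs mM lotS) Y0 set0U => ls.
have [x xD xD'] : exists2 x, x \in down r m & x \notin down r m'.
  apply/subsetPn; apply: contra DD' => DD'.
  by rewrite eqEsubset DD' -setD_eq0 Y0 eqxx.
have xS : x \notin twins r m m' by rewrite (disjointFr (down_twins r m m' m) xD).
have Fc := @moved_count_convex r m m'.
have FM := moved_count_le l_gt1 forks_le (m := m) (m' := m') rs.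
have Fp1 := convex_left Fc p0 (ltnW ps) ltac:(lia).
have := @convex_slope _ _ Fc p.-1 p ltac:(lia) ps; rewrite prednK // => Fp2.
have := @convex_incr _ _ Fc 1 p #|twins r m m'| ltac:(lia) ltac:(lia) ltac:(lia).
have := FM p.+1 ps; move=> Fp3 Fp4.
have := @retop_count_strict_convex T l r (twins r m m') (down r m) (down r m') x p.-1
  ltac:(lia) ltac:(lia) ls xS xD xD'.
rewrite prednK // -!/(moved_count l r m m' _); lia.
Qed.

(** The last hypothesis keeps the other end away from [M - 1] copies. When [D'] is contained in [D],
    [merge_down] makes that end optimal and LOT, and [merge_up] applies with the roles exchanged. *)
Lemma merge_half r m m' : strict r -> m \in maxs r -> m' \in maxs r ->
    down r m != down r m' -> M <= (forks l r).+1 ->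
    lot (moved r m m' (twins r m m')) ->
    moved_count l r m m' #|twins r m m'| = M ->
    moved_count l r m' m #|twins r m' m| + 2 <= M \/
    moved_count l r m' m #|twins r m' m| = M /\ lot (moved r m' m (twins r m' m)) ->
  resolved.
Proof.
move=> rs mM m'M DD' Fr lotS Fs H0.
have [Y0|Y0] := eqVneq (down r m' :\: down r m) set0; last first.
  by apply: (@merge_up r m m'); rewrite // moved_count0 //; lia.
have := merge_down rs mM m'M DD' lotS Fs Fr Y0; rewrite moved_count0 //.
case: H0 => [|[F0 lot0] _]; first lia.
have D'D : down r m' != down r m by rewrite eq_sym.
apply: (@merge_up r m' m) => //; last by rewrite moved_count0 //; lia.
by apply: contra DD' => D0; rewrite eqEsubset -!setD_eq0 D0 Y0 eqxx.
Qed.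

(* Lexicographic: the factor exceeds every possible number of down-sets. *)
Definition unevenness r :=
  #|~: maxs r| * #|T|.+1 + #|[set down r x | x in maxs r]|.

(** Old tops stay maximal. If no new one appears, [D'] vanishes from the set of down-sets and none
    is added. *)
Lemma unevenness_moved r m m' : strict r -> m \in maxs r -> m' \in maxs r ->
  down r m != down r m' -> unevenness (moved r m m' (twins r m m')) < unevenness r.
Proof.
move=> rs mM m'M DD'; set r' := moved _ _ _ _.
have sub : maxs r \subset maxs r' by apply: maxs_moved.
have [eqM|neM] := eqVneq (maxs r) (maxs r').
  rewrite /unevenness -eqM ltn_add2l.
  apply: (@leq_ltn_trans #|[set down r x | x in maxs r] :\ down r m'|).
    apply/subset_leq_card/subsetP => _ /imsetP[z zM ->]; rewrite in_setD1.
    have [zS|zS] := boolP (z \in twins r m m').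
      have -> : down r' z = down r m.
        by apply/setP => x; rewrite !inE /r' /moved /retop zS inE.
      by rewrite DD' imset_f.
    have -> : down r' z = down r z.
      by apply/setP => x; rewrite !inE /r' /moved /retop (negbTE zS).
    rewrite imset_f // andbT; apply: contra zS => /eqP zE.
    by rewrite inE zM zE eqxx orbT.
  by rewrite [ltnRHS](cardsD1 (down r m')) imset_f.
have lt : #|~: maxs r'| < #|~: maxs r|.
  by apply: proper_card; rewrite properC properEneq neM.
have le : #|[set down r' x | x in maxs r']| <= #|T|.
  exact: leq_trans (leq_imset_card _ _) (max_card _).
by rewrite /unevenness; nia.
Qed.

(** Merging the twins at either end lowers [unevenness], so induction applies to each end having at
    least [M - 1] copies. If all tops share one down-set, [r] is LOT. *)
Lemma near_max_lot r : strict r -> M <= (forks l r).+1 -> lot r \/ resolved.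
Proof.
have [n] := ubnP (unevenness r); elim: n r => // n IHn r /ltnSE rn rs Fr.
case: (boolP [forall m in maxs r, forall m' in maxs r, down r m == down r m']).
  move=> /forall_inP eqd; left; apply: lot_downs => // m m' mM m'M.
  by have /forall_inP/(_ m' m'M)/eqP := eqd m mM.
move=> /forall_inPn[m mM /forall_inPn[m' m'M DD']]; right.
have merged u v : u \in maxs r -> v \in maxs r -> down r u != down r v ->
    [\/ resolved, moved_count l r u v #|twins r u v| + 2 <= M
      | moved_count l r u v #|twins r u v| = M /\ lot (moved r u v (twins r u v))].
  move=> uM vM uv; have FM := moved_count_le l_gt1 forks_le rs (leqnn #|twins r u v|).
  have [|Fs] := leqP (moved_count l r u v #|twins r u v| + 2) M; first by move=> ?; apply: Or32.
  have Ft : forks l (moved r u v (twins r u v)) = moved_count l r u v #|twins r u v|.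
    by rewrite moved_countE.
  have := IHn _ (leq_trans (unevenness_moved rs uM vM uv) rn) (moved_strict u v rs _).
  case=> [|lotS|]; [rewrite Ft; lia| |by move=> ?; apply: Or31].
  have [E|N] := eqVneq (moved_count l r u v #|twins r u v|) M; first by apply: Or33.
  apply/Or31/Or31; exists (moved r u v (twins r u v)); split=> //; first exact: moved_strict.
  by rewrite Ft; lia.
have D'D : down r m' != down r m by rewrite eq_sym.
have [//|F1|[F1 lot1]] := merged m m' mM m'M DD'.
  have [//|F2|[F2 lot2]] := merged m' m m'M mM D'D; last first.
    by apply: (@merge_half r m' m) => //; left.
  (* Both ends have at most [M - 2] copies, while a convex [F] with [F p >= M - 1] inside would
     reach that value at an end. *)
  have [p [p0 ps Fp]] := near_max_index rs mM m'M DD'.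
  have Fc := @moved_count_convex r m m'.
  have F0 := moved_count0 m m' rs.
  have Fp1 := convex_left Fc p0 (ltnW ps) ltac:(lia).
  have := @convex_incr _ _ Fc 1 p.-1 #|twins r m m'|; rewrite prednK // addn1 => H.
  have := H Fp1 ltac:(lia) (leqnn _); have := @convex_slope _ _ Fc p.-1 p ltac:(lia) ps.
  have := @convex_incr _ _ Fc 1 p #|twins r m m'|.
  rewrite prednK //; lia.
have [//|F2|F2] := merged m' m m'M mM D'D.
  by apply: (@merge_half r m m') => //; left.
by apply: (@merge_half r m m') => //; right.
Qed.

End NearMax.

(** * From strict relations back to posets *)

Fact strict_poset_display : Order.disp_t. Proof. exact: Order.Disp tt tt. Qed.

Definition strict_poset (T : finType) (r : rel T) (rs : strict r) : Type := T.

Section StrictPoset.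
Variables (T : finType) (r : rel T) (rs : strict r).
HB.instance Definition _ := Finite.on (strict_poset rs).
HB.instance Definition _ := Order.Lt_isPOrder.Build strict_poset_display
  (strict_poset rs) (proj1 rs) (proj2 rs).
End StrictPoset.

Section Bridge.

Variables (d : Order.disp_t) (P : finPOrderType d).
Local Notation lt := (fun x y : P => (x < y)%O).

Lemma lt_strict : strict lt.
Proof. by split=> [x|y x z]; [apply: ltxx|apply: lt_trans]. Qed.

Lemma lot_LOT : lot lt -> LOT P.
Proof.
move=> lP; have H (u v : ordsum (subposet (~: maximals P)) (subposet (maximals P))) :
    (ordsum_to_carrier u <= ordsum_to_carrier v)%O = (u <= v)%O.
  case: u v => [[x xP]|[x xP]] [[y yP]|[y yP]] //=.
    by apply/ltW/lP => //; move: xP; rewrite in_setC.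
  rewrite -[RHS]/false; apply/negbTE; apply: contraTN yP => xy.
  rewrite in_setC negbK; move: xy; rewrite le_eqVlt => /orP[/eqP <- //|].
  by move: xP; rewrite inE => /forallP/(_ y)/negbTE ->.
split=> //; apply: inj_card_bij.
  by move=> u v uv; apply/le_anti; rewrite -!H uv lexx.
by rewrite card_sum !card_sig addnC cardsC.
Qed.

Variable l : nat.
Hypothesis l_gt1 : 1 < l.
Local Notation Q := (ordsum (antichain 1) (antichain l)).

Lemma fork_isomorphic (x : P) (A : {set P}) : fork lt x A -> #|A| = l ->
  isomorphic (subposet (x |: A)) Q.
Proof.
move=> /forkP[xA AA] cA.
have aP (i : 'I_l) : enum_val (cast_ord (esym cA) i) \in A by apply: enum_valP.
pose h (q : Q) : P := match q with inl _ => x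
                                 | inr i => enum_val (cast_ord (esym cA) i) end.
have hP q : h q \in x |: A.
  by case: q => i; rewrite in_setU1 /= ?eqxx // aP orbT.
pose g q : subposet (x |: A) := exist _ (h q) (hP q).
have gM : {mono g : p q / (p <= q)%O}.
  move=> p q; rewrite -[LHS]/(h p <= h q)%O; case: p q => [i|i] [j|j] /=.
  - by rewrite lexx; apply/esym/eqP; rewrite (ord1 i) (ord1 j).
  - by apply/ltW/xA.
  - apply/negbTE; apply/negP => /le_lt_trans/(_ (xA _ (aP i))).
    by rewrite ltxx.
  - rewrite le_eqVlt (negbTE (AA _ _ _ _)) ?aP // orbF.
    by rewrite (inj_eq enum_val_inj) (inj_eq (@cast_ord_inj _ _ _)).
have gI : injective g by move=> p q pq; apply/le_anti; rewrite -!gM pq lexx.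
have [f gK fK] : bijective g.
  apply: inj_card_bij => //; rewrite card_sig card_sum !card_ord.
  by rewrite -[leqLHS]/#|x |: A| cardsU1 cA leq_add2r leq_b1.
apply/isomorphicP; exists f; split; first by exists g.
by move=> u v; rewrite -gM !fK.
Qed.

Lemma isomorphic_fork (S : {set P}) : isomorphic (subposet S) Q ->
  exists x A, [/\ fork lt x A, #|A| = l & S = x |: A].
Proof.
move=> /isomorphicP[f [[g fK gK] fM]].
have gM : {mono g : p q / (p <= q)%O} by move=> p q; rewrite -fM !gK.
have gI := can_inj gK.
pose h (q : Q) : P := val (g q).
have hI : injective h by move=> p q /val_inj/gI.
have hM : {mono h : p q / (p <= q)%O} by move=> p q; rewrite -gM.
have hL : {mono h : p q / (p < q)%O}.
  by move=> p q; rewrite !lt_neqAle hM (inj_eq hI).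
exists (h (inl ord0)), [set h (inr i) | i : 'I_l]; split.
- apply/forkP; split=> [_ /imsetP[i _ ->]|_ _ /imsetP[i _ ->] /imsetP[j _ ->]].
    by rewrite hL.
  by rewrite hL lt_neqAle; apply/negP => /andP[/negP ij /eqP E]; apply: ij; rewrite E.
- by rewrite card_imset ?card_ord // => i j /hI[].
- apply/setP => y; rewrite in_setU1; apply/idP/idP.
    move=> yS; have -> : y = h (f (exist _ y yS)) by rewrite /h fK.
    case: (f _) => i; first by rewrite (ord1 i) eqxx.
    by apply/orP; right; apply/imsetP; exists i.
  by case/orP=> [/eqP ->|/imsetP[i _ ->]]; apply: valP.
Qed.

(** Copies are sets and forks are pairs; the set determines its bottom, since two distinct bottoms
    would lie below each other. *)
Lemma count_copies_forks : count_copies Q P = forks l lt.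
Proof.
rewrite /forks /count_copies; under eq_bigr do rewrite -sum1dep_card.
rewrite pair_big_dep /= sum1dep_card.
rewrite -[RHS](card_in_imset (f := fun p : P * {set P} => p.1 |: p.2)).
  apply: eq_card => S; rewrite inE; apply/idP/imsetP.
    move=> /isomorphic_fork[x [A [fA cA ->]]]; exists (x, A) => //.
    by rewrite inE fA cA eqxx.
  move=> [[x A]]; rewrite inE => /andP[fA /eqP cA] ->.
  exact: fork_isomorphic.
move=> [x A] [y B]; rewrite !inE /= => /andP[/forkP[xA _] _] /andP[/forkP[yB _] _] E.
have xNA : x \notin A by apply/negP => /xA; rewrite ltxx.
have yNB : y \notin B by apply/negP => /yB; rewrite ltxx.
have xy : x = y.
  have := setU11 x A; rewrite E in_setU1 => /orP[/eqP//|/yB yx].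
  have := setU11 y B; rewrite -E in_setU1 => /orP[/eqP//|/xA xy].
  by have := lt_trans xy yx; rewrite ltxx.
rewrite xy in xNA E *; congr (_, _).
by rewrite -(setU1K xNA) E setU1K.
Qed.

End Bridge.

Theorem theorem7p9 (l : nat) (hl : 2 <= l)
    (d : Order.disp_t) (P : finPOrderType d)
    (hP : (count_copies (ordsum (antichain 1) (antichain l)) P).+1
          = max_copies #|P| (ordsum (antichain 1) (antichain l))) :
  exists (d' : Order.disp_t) (Q : finPOrderType d'),
    #|Q| = #|P| /\
    [\/ (count_copies (ordsum (antichain 1) (antichain l)) Q).+1
        = max_copies #|P| (ordsum (antichain 1) (antichain l)) /\ LOT Q,
        optimal (ordsum (antichain 1) (antichain l)) Q /\ #|maximals Q| = l
      | l = 2 /\ #|P| = 5].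
Proof.
set M := max_copies _ _ in hP *.
(* Every strict order on [P] is a poset with [#|P|] elements, so [M] bounds its copies. *)
have forks_le (r : rel P) : strict r -> forks l r <= M.
  move=> rs; rewrite -(count_copies_forks (strict_poset rs)).
  exact: (count_copies_le_max _ (strict_poset rs)).
have M0 : 0 < M by rewrite -hP.
have near : M <= (forks l (fun x y : P => (x < y)%O)).+1.
  by rewrite -(count_copies_forks P) hP.
have [lP|] := near_max_lot hl M0 forks_le (lt_strict P) near.
  by exists d, P; split=> //; apply: Or31; split=> //; apply: lot_LOT.
case=> [[r [rs lr rM]]|[r [rs rM cr]]|lP].
- exists strict_poset_display, (strict_poset rs); split=> //; apply: Or31.
  split; last exact: lot_LOT.
  by rewrite (count_copies_forks (strict_poset rs)).
- exists strict_poset_display, (strict_poset rs); split=> //; apply: Or32; split=> //.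
  by rewrite /optimal (count_copies_forks (strict_poset rs)).
- by exists d, P; split=> //; apply: Or33.
Qed.
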